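(* Let $p$ be a prime and let $A$ be a countably infinite elementary abelian $p$-group. Then there exists a ring topology on $R=\mathrm{End} A$ which is not admissible.
   Context: An elementary $p$-group is an abelian group $A$ with $pA=0$. $\mathrm{End} A$ is the ring of endomorphisms of $A$. The finite topology $\mathcal{T}_{fin}$ on $\mathrm{End} A$ has as a fundamental system of neighborhoods of zero the sets $T(K)=\{\alpha\in \mathrm{End} A\mid \alpha K=0\}$, $K$ running over all finite subsets of $A$. A ring topology $\mathcal{T}$ on $\mathrm{End} A$ is called admissible if $\mathcal{T}\geq \mathcal{T}_{fin}$, i.e. every $\mathcal{T}_{fin}$-open set is $\mathcal{T}$-open. *)

(* Defs.v *)
From HB Require Import structures.
From mathcomp Require Import all_boot all_order all_algebra.
From mathcomp Require Import boolp classical_sets functions cardinality topology.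

Set Implicit Arguments.
Unset Strict Implicit.
Unset Printing Implicit Defensive.

Import GRing.Theory.
Local Open Scope classical_set_scope.
Local Open Scope ring_scope.

Definition elementary_group (p : nat) (A : zmodType) : Prop :=
  forall a : A, a *+ p = 0.

(* Endomorphisms act on the left: the product is composition, so that
   (f * g) a = f (g a).  The zero group is allowed, hence pzRingType. *)
Definition End (A : zmodType) : Type := {additive A -> A}.

Section EndRing.
Variable A : zmodType.
Implicit Types f g h : End A.

HB.instance Definition _ := gen_eqMixin (End A).
HB.instance Definition _ := gen_choiceMixin (End A).

Definition End_apply f : A -> A := (f : {additive A -> A}).

Lemma EndP f g : End_apply f =1 End_apply g -> f = g.
Proof.
rewrite /End_apply; case: f => f [[mf]]; case: g => g [[mg]] /= /funext fg.
by subst g; congr (GRing.Additive.Pack _); congr (GRing.Additive.Class _);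
   congr GRing.isNmodMorphism.Axioms_; exact: Prop_irrelevance.
Qed.

Definition End0 : End A := (\0 : A -> A).
Definition End_opp f : End A := (\- (f : {additive A -> A}) : A -> A).
Definition End_add f g : End A :=
  ((f : {additive A -> A}) \+ (g : {additive A -> A}) : A -> A).
Definition End1 : End A := (idfun : A -> A).
Definition End_mul f g : End A :=
  ((f : {additive A -> A}) \o (g : {additive A -> A}) : A -> A).

Fact End_addA : associative End_add.
Proof. by move=> f g h; apply: EndP => a; exact: addrA. Qed.
Fact End_addC : commutative End_add.
Proof. by move=> f g; apply: EndP => a; exact: addrC. Qed.
Fact End_add0 : left_id End0 End_add.
Proof. by move=> f; apply: EndP => a; exact: add0r. Qed.
Fact End_addN : left_inverse End0 End_opp End_add.
Proof. by move=> f; apply: EndP => a; exact: addNr. Qed.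

HB.instance Definition _ :=
  GRing.isZmodule.Build (End A) End_addA End_addC End_add0 End_addN.

Fact End_mulA : associative End_mul.
Proof. by move=> f g h; exact: EndP. Qed.
Fact End_mul1l : left_id End1 End_mul.
Proof. by move=> f; exact: EndP. Qed.
Fact End_mul1r : right_id End1 End_mul.
Proof. by move=> f; exact: EndP. Qed.
Fact End_mulDl : left_distributive End_mul +%R.
Proof. by move=> f g h; exact: EndP. Qed.
Fact End_mulDr : right_distributive End_mul +%R.
Proof.
by move=> f g h; apply: EndP => a; exact: (raddfD (f : {additive A -> A})).
Qed.

HB.instance Definition _ := GRing.Zmodule_isPzRing.Build (End A)
  End_mulA End_mul1l End_mul1r End_mulDl End_mulDr.

End EndRing.

Coercion End_apply : End >-> Funclass.

Record topology_on (T : choiceType) := TopologyOn {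
  is_open : set (set T);
  is_openT : is_open setT;
  is_openI : setI_closed is_open;
  is_open_bigcup : forall (I : Type) (f : I -> set T),
    (forall i, is_open (f i)) -> is_open (\bigcup_i f i)
}.

(* A copy of T whose canonical topologicalType structure is the one given by
   tau; this gives access to the library's notions (continuity, product
   topology, separation) for a topology that is quantified over. *)
Definition topologized (T : choiceType) (tau : topology_on T) : Type := T.

Section Topologized.
Variables (T : choiceType) (tau : topology_on T).
HB.instance Definition _ := Choice.on (topologized tau).
HB.instance Definition _ := isOpenTopological.Build (topologized tau)
  (is_openT tau) (@is_openI T tau) (@is_open_bigcup T tau).
End Topologized.

Definition finer (T : choiceType) (tau sigma : topology_on T) : Prop :=
  is_open sigma `<=` is_open tau.

Definition ring_topology (R : pzRingType) (tau : topology_on R) : Prop :=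
  let X := topologized tau in
  [/\ continuous (fun z : X * X => ((z.1 : R) + (z.2 : R)) : X),
      continuous (fun x : X => (- (x : R)) : X)
    & continuous (fun z : X * X => ((z.1 : R) * (z.2 : R)) : X)].

Section FiniteTopology.
Variable A : zmodType.

Definition annihilator (K : set A) : set (End A) :=
  [set f : End A | forall a, K a -> f a = 0].

Definition finite_open (U : set (End A)) : Prop :=
  forall f, U f -> exists2 K : set A, finite_set K &
    [set f + g | g in annihilator K] `<=` U.

Fact finite_openT : finite_open setT.
Proof. by move=> f _; exists set0. Qed.

Fact finite_openI : setI_closed finite_open.
Proof.
move=> U V oU oV f [/oU[K finK KU] /oV[L finL LV]].
exists (K `|` L); first by rewrite finite_setU.
move=> _ [g gKL <-]; split.
  by apply: KU; exists g => // a Ka; apply: gKL; left.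
by apply: LV; exists g => // a La; apply: gKL; right.
Qed.

Fact finite_open_bigcup (I : Type) (F : I -> set (End A)) :
  (forall i, finite_open (F i)) -> finite_open (\bigcup_i F i).
Proof.
move=> oF f [i _ /oF[K finK KF]]; exists K => // g /KF Fg.
by exists i.
Qed.

Definition finite_topology : topology_on (End A) :=
  TopologyOn finite_openT finite_openI finite_open_bigcup.

Definition admissible (tau : topology_on (End A)) : Prop :=
  finer tau finite_topology.

End FiniteTopology.

(* Main.v *)
Require Import Defs.
From HB Require Import structures.
From mathcomp Require Import all_boot all_order all_algebra.
From mathcomp Require Import boolp classical_sets functions cardinality topology.

Set Implicit Arguments.
Unset Strict Implicit.
Unset Printing Implicit Defensive.

Local Open Scope classical_set_scope.
Local Open Scope ring_scope.

Import GRing.Theory.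

(** The finite topology is the topology of pointwise convergence, whose basic
    neighbourhoods of zero are left ideals.  No Hausdorff topology with a basis of
    left ideals can work: a faithful left module over End A contains a copy of A,
    so its annihilators already refine the finite topology.  The way out is to
    use right ideals.  Call two endomorphisms x and y close when they agree
    after composition on the left with a homomorphism phi from A to a finite
    group; equivalently, when x - y maps A into a prescribed subgroup of
    finite index.  This is uniform convergence for the profinite topology of A.

    It is a ring topology ([profinite_ring_topology]).  The delicate point is
    left multiplication by a fixed x: controlling x y modulo phi amounts to
    controlling y modulo phi o x, which is again a homomorphism to the same
    finite group.

    It is Hausdorff ([profinite_hausdorff]) as soon as homomorphisms to finite
    groups separate the points of A.  For an elementary p-group, a linear form
    that is nonzero at a given point exists
    ([exists_separating_functional]).

    It is not admissible.  Fix a nonzero a; if the annihilator of a were open,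
    it would contain every endomorphism killed by some phi from A to a finite
    group.  As A is infinite, phi kills some b <> 0
    ([finite_quotient_kernel]).  With f a linear form such that f a = 1, the
    rank one map z |-> f(z) b is killed by phi but sends a to b. *)

(** * Linear forms on an elementary p-group *)

Section ElementaryGroup.
Variables (p : nat) (A : zmodType).
Hypotheses (p_prime : prime p) (A_elementary : elementary_group p A).

Lemma elementary_mulrn_mod (a : A) n : a *+ (n %% p)%N = a *+ n.
Proof.
by rewrite [in RHS](divn_eq n p) mulrnDr mulnC mulrnA A_elementary mul0rn add0r.
Qed.

Lemma elementary_mulrn_inv n : ~~ (p %| n)%N ->
  exists m, forall a : A, a *+ n *+ m = a.
Proof.
move=> pn; have n_gt0 : (0 < n)%N by case: n pn => //; rewrite dvdn0.
move: pn; rewrite -prime_coprime // => cop.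
have [u v uv _] := egcdnP p n_gt0.
exists u => a; rewrite -mulrnA mulnC uv gcdnC (eqP cop) addn1 mulrS.
by rewrite mulnC mulrnA A_elementary mul0rn addr0.
Qed.

Lemma elementary_mulrn_FpD (a : A) (k l : 'F_p) :
  a *+ (k + l)%R = a *+ k + a *+ l.
Proof.
rewrite -mulrnDr -[RHS]elementary_mulrn_mod.
by congr (a *+ _); congr (_ %% _)%N; exact: Fp_cast.
Qed.

(** Since -a = (p - 1) a in an elementary group, closure under addition is
    enough to describe subgroups, except that the empty set is included.
    Allowing it makes the family of those avoiding a given point stable under
    unions of all chains, the empty one too, as Zorn's lemma requires. *)
Definition add_closed (M : set A) := forall a b, M a -> M b -> M (a + b).

Lemma add_closed_mulrn (M : set A) a n :
  add_closed M -> M a -> M (a *+ n.+1).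
Proof.
by move=> MD Ma; elim: n => // n IHn; rewrite mulrS; apply: MD.
Qed.

Lemma add_closed_zmod_closed (M : set A) : M !=set0 -> add_closed M ->
  [/\ M 0, forall a, M a -> M (- a) & forall a n, M a -> M (a *+ n)].
Proof.
move=> [m Mm] MD.
have M0 : M 0.
  rewrite -(A_elementary m) -(prednK (prime_gt0 p_prime)).
  exact: add_closed_mulrn.
have Mn a n : M a -> M (a *+ n) by case: n => // n; apply: add_closed_mulrn.
split=> // a Ma; suff -> : - a = a *+ p.-1 by exact: Mn.
apply/eqP; rewrite eq_sym -addr_eq0 -mulrSr prednK ?prime_gt0 //.
exact/eqP/A_elementary.
Qed.

Lemma exists_maximal_avoiding (a : A) : a != 0 ->
  exists M : set A, [/\ M !=set0, add_closed M, ~ M a &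
    forall N : set A, add_closed N -> M `<=` N -> ~ N a -> N `<=` M].
Proof.
move=> a0; pose P : set (set A) := [set M | add_closed M /\ ~ M a].
have chainP (F : set (set A)) :
    F `<=` P -> total_on F subset -> P (\bigcup_(X in F) X).
  move=> FP Ftot; split=> [x y [X FX Xx] [Y FY Yy]|[X /FP[_ XNa]] //].
  have [XY|YX] := Ftot X Y FX FY.
    by exists Y => //; apply: (FP Y FY).1 => //; apply: XY.
  by exists X => //; apply: (FP X FX).1 => //; apply: YX.
have [M [[MD MNa] Mmax]] := Zorn_bigcup chainP.
exists M; split=> // [|N ND MN NNa]; last first.
  by apply: contrapT => NM; apply: (Mmax N).
(* The empty set is not maximal: {0} is larger and avoids a. *)
apply/set0P/negP => /eqP M0; apply: (Mmax [set 0]).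
  rewrite M0; split=> [x //|]; exact: (fun h => h 0 erefl).
by split=> [x y /= -> ->|/eqP]; [rewrite addr0 | rewrite (negbTE a0)].
Qed.

(** A subgroup M maximal among those avoiding [a] is a hyperplane complementary
    to the line of [a]: if x is not in M, then M + <x> contains [a], so [a] is
    a multiple of x modulo M, by a scalar that is invertible because [a] is not
    in M.  The form is the coordinate along [a] modulo M. *)
Lemma exists_separating_functional (a : A) : a != 0 ->
  exists f : {additive A -> 'F_p}, f a = 1.
Proof.
move=> a0; have [M [Mn0 MD MNa Mmax]] := exists_maximal_avoiding a0.
have [M0 MN Mn] := add_closed_zmod_closed Mn0 MD.
have Fpn n : M (a *+ n) -> (p %| n)%N.
  by apply: contraPT => /elementary_mulrn_inv[m mK] /(Mn _ m); rewrite mK.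
have exk x : exists k : 'F_p, M (x - a *+ k).
  have [Mx|NMx] := pselect (M x); first by exists 0; rewrite mulr0n subr0.
  pose N := [set y | exists n, M (y - x *+ n)].
  have Na : N a.
    apply: contrapT => NNa; apply/NMx/(Mmax N) => //; last first.
    - by exists 1%N; rewrite subrr.
    - by move=> y My; exists 0%N; rewrite subr0.
    move=> y z [n Hn] [m Hm]; exists (n + m)%N.
    by rewrite mulrnDr opprD addrACA; exact: MD.
  have [n Mxn] := Na.
  (* a = n x modulo M with n prime to p; dividing by n gives x = m a
     modulo M. *)
  have [m mK] : exists m, forall b : A, b *+ n *+ m = b.
    apply: elementary_mulrn_inv; apply/negP => /dvdnP[q nq].
    apply: MNa; move: Mxn.
    by rewrite nq mulnC mulrnA A_elementary mul0rn subr0.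
  exists (m%:R); rewrite val_Fp_nat // elementary_mulrn_mod.
  have /(Mn _ m)/MN := Mxn.
  by rewrite mulrnBl mK opprB.
have [f fP] := choice exk.
have f_unique x (k : 'F_p) : M (x - a *+ k) -> f x = k.
  have: forall k l : 'F_p, (k <= l)%N ->
      M (x - a *+ k) -> M (x - a *+ l) -> k = l.
    move=> {}k l kl Mk /MN Ml; apply: val_inj => /=.
    have /Fpn : M (a *+ (l - k)%N).
      by rewrite mulrnBr //; move: (MD _ _ Mk Ml); rewrite opprB addrC subrKA.
    rewrite -eqn_mod_dvd // => /eqP.
    by rewrite !modn_small // -[X in (_ < X)%N](Fp_cast p_prime) ltn_ord.
  by move=> H Mk; have [le|/ltnW le] := leqP (f x) k; [|symmetry]; exact: H.
have fB : zmod_morphism f.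
  move=> x y; apply/f_unique.
  have -> : a *+ (f x - f y)%R = a *+ f x - a *+ f y.
    by apply/eqP; rewrite -subr_eq opprK -elementary_mulrn_FpD subrK.
  by rewrite opprD addrACA -opprD; apply: MD => //; apply/MN.
exists (HB.pack f (GRing.isZmodMorphism.Build A 'F_p f fB)
         : {additive A -> 'F_p}).
apply: f_unique.
have -> : nat_of_ord (1%R : 'F_p) = 1%N by [].
by rewrite subrr.
Qed.

(** The endomorphisms of rank at most one: the image is spanned by [b], which
    may be taken in the kernel of a prescribed map while [f] is arbitrary. *)
Lemma exists_rank_one (f : {additive A -> 'F_p}) (b : A) :
  exists e : End A, forall a, e a = b *+ f a.
Proof.
pose g a := b *+ f a.
have g0 : g 0 = 0 by rewrite /g raddf0.
have gD : {morph g : x y / x + y}.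
  by move=> x y; rewrite /g raddfD; exact: elementary_mulrn_FpD.
by exists (HB.pack g (GRing.isNmodMorphism.Build A A g (g0, gD))
            : {additive A -> A}).
Qed.

End ElementaryGroup.

(** * Uniform convergence modulo subgroups of finite index *)

Section ProfiniteTopology.
Variable A : zmodType.

Definition congruent_along (B : zmodType) (phi : {additive A -> B})
  (x y : End A) := forall a, phi (x a) = phi (y a).

(** Finite homomorphic images stand for subgroups of finite index: composing
    with endomorphisms and forming pairs then replace inverse images and
    intersections of subgroups. *)
Definition basic_nbhs (x : End A) (U : set (End A)) : Prop :=
  exists (B : zmodType) (phi : {additive A -> B}),
    finite_set [set: B] /\ congruent_along phi x `<=` U.

Definition profinite_open (U : set (End A)) : Prop :=
  forall x, U x -> basic_nbhs x U.

Fact profinite_openT : profinite_open setT.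
Proof.
move=> x _; exists 'rV['F_2]_0, \0; split=> //; exact: finite_finset.
Qed.

Fact profinite_openI : setI_closed profinite_open.
Proof.
move=> U V oU oV x [/oU[B [phi [finB BU]]] /oV[C [psi [finC CV]]]].
pose f a := (phi a, psi a).
have fB : zmod_morphism f by move=> a b; rewrite /f !raddfB.
exists (B * C)%type,
  (HB.pack f (GRing.isZmodMorphism.Build A _ f fB) : {additive A -> B * C}).
split; first by rewrite -setXTT; exact: finite_setX.
by move=> y xy; split; [apply: BU | apply: CV] => a; have [] := xy a.
Qed.

Fact profinite_open_bigcup (I : Type) (F : I -> set (End A)) :
  (forall i, profinite_open (F i)) -> profinite_open (\bigcup_i F i).
Proof.
move=> oF x [i _ /oF[B [phi [finB BF]]]].
by exists B, phi; split=> // y /BF Fy; exists i.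
Qed.

Definition profinite_topology : topology_on (End A) :=
  TopologyOn profinite_openT profinite_openI profinite_open_bigcup.

Local Notation X := (topologized profinite_topology).

Lemma profinite_open_congruent (B : zmodType) (phi : {additive A -> B})
  (x : End A) : finite_set [set: B] -> open (congruent_along phi x : set X).
Proof.
move=> finB; change (profinite_open (congruent_along phi x)) => y xy.
exists B, phi; split=> // z yz a.
by rewrite xy.
Qed.

Lemma nbhs_profiniteP (x : X) (U : set X) : nbhs x U <-> basic_nbhs x U.
Proof.
rewrite nbhsE; split=> [[V [oV Vx] VU]|[B [phi [finB BU]]]].
  have [B [phi [finB BV]]] := oV x Vx.
  by exists B, phi; split=> //; apply: subset_trans VU.
exists (congruent_along phi x) => //; split=> //.
exact: profinite_open_congruent.
Qed.

Lemma nbhs_profinite_congruent (B : zmodType) (phi : {additive A -> B})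
  (x : X) : finite_set [set: B] -> nbhs x (congruent_along phi x : set X).
Proof. by move=> finB; apply/nbhs_profiniteP; exists B, phi; split. Qed.

(** For the product, x' y' is compared with x y' along phi, uniformly in the
    argument y' a, and then x y' with x y along phi o x. *)
Lemma profinite_ring_topology : ring_topology profinite_topology.
Proof.
split=> [[x y]|x|[x y]] U /nbhs_profiniteP[B [phi [finB BU]]].
- exists (congruent_along phi x, congruent_along phi y).
    by split; exact: nbhs_profinite_congruent.
  move=> [x' y'] [/= xx' yy']; apply: BU => a.
  change (phi (x a + y a) = phi (x' a + y' a)).
  by rewrite !raddfD xx' yy'.
- apply/nbhs_profiniteP; exists B, phi; split=> // x' xx'; apply: BU => a.
  change (phi (- x a) = phi (- x' a)).
  by rewrite !raddfN xx'.
- pose phix : {additive A -> B} := phi \o (x : {additive A -> A}).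
  exists (congruent_along phi x, congruent_along phix y).
    by split; exact: nbhs_profinite_congruent.
  move=> [x' y'] [/= xx' yy']; apply: BU => a.
  change (phi (x (y a)) = phi (x' (y' a))).
  by rewrite -xx'; exact: yy'.
Qed.

Lemma profinite_hausdorff :
    (forall a : A, a != 0 -> exists (B : zmodType) (phi : {additive A -> B}),
      finite_set [set: B] /\ phi a != 0) ->
  hausdorff_space X.
Proof.
move=> sep x y xy; apply: EndP => a; apply/eqP; rewrite -subr_eq0.
apply/negPn/negP => /sep[B [phi [finB]]].
have [z [xz yz]] := xy _ _ (nbhs_profinite_congruent phi x finB)
                          (nbhs_profinite_congruent phi y finB).
by rewrite raddfB xz yz subrr eqxx.
Qed.

(** A homomorphism without kernel would embed the infinite [A] in a finite
    group. *)
Lemma finite_quotient_kernel (B : zmodType) (phi : {additive A -> B}) :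
  infinite_set [set: A] -> finite_set [set: B] ->
  exists2 b, b != 0 & phi b = 0.
Proof.
move=> infA finB; apply: contrapT => kernel0; apply: infA.
rewrite -(preimage_setT phi); apply: finite_preimage => //.
move=> a b _ _ ab; apply/eqP; rewrite -subr_eq0; apply/negPn/negP => ab0.
by apply: kernel0; exists (a - b) => //; rewrite raddfB ab subrr.
Qed.

End ProfiniteTopology.

(** * A Hausdorff ring topology that is not admissible *)

Theorem theorem5 (p : nat) (A : zmodType) (p_prime : prime p)
    (A_elementary : elementary_group p A)
    (A_countable : countable [set: A]) (A_infinite : infinite_set [set: A]) :
  exists tau : topology_on (End A),
    [/\ ring_topology tau,
        hausdorff_space (topologized tau)
      & ~ admissible tau].
Proof.
exists (profinite_topology A); split.
- exact: profinite_ring_topology.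
- apply: profinite_hausdorff => a /(exists_separating_functional p_prime).
  move=> /(_ A_elementary)[f fa]; exists 'F_p, f.
  by rewrite fa oner_eq0; split=> //; exact: finite_finset.
move=> adm.
(* The kernel of the zero map provides a nonzero element of A. *)
have [a a0 _] :=
  finite_quotient_kernel (\0 : {additive A -> 'F_p}) A_infinite finite_finset.
have open_ann : profinite_open (annihilator [set a]).
  apply: (adm (annihilator [set a])) => x xa; exists [set a] => //.
  move=> _ [g ga <-] b ba; change (x b + g b = 0).
  by rewrite xa // ga // addr0.
have [//|B [phi [finB phiU]]] := open_ann 0.
have [b b0 phib] := finite_quotient_kernel phi A_infinite finB.
have [f fa] := exists_separating_functional p_prime A_elementary a0.
have [e ef] := exists_rank_one p_prime A_elementary f b.
have ea : e a = 0.
  apply: phiU => // c; rewrite ef raddfMn phib mul0rn.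
  exact: raddf0.
by move: b0; rewrite -ea ef fa eqxx.
Qed.
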